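(* Let $M=\{\mathcal A,\mathcal H,ds\}$ be a connected spectral geometry of density $D>2$ on a compact metric space $(X,|\cdot|)$, with support $B=\mathrm{supp}\,M$. Let $\rho_0$ be (the marked spectrum of) a bounded deformation of $M$ and $\{\rho_i\}_{i\ge1}$ a sequence of deformations of $M$ converging to $\rho_0$ in the compact-open topology, such that for some constant $C>0$ $$\rho_0(y,y')\le\rho_i(y,y')\le C|yy'|\quad\text{for all }(y,y')\in B,\ i\ge1.$$ Then the Connes metrics $d_i=d_{\rho_i}$ on $X$ converge in the Hausdorff–Gromov sense to the Connes metric $d_0=d_{\rho_0}$, i.e. $(X,d_i)\to(X,d_0)$.
   Context: $|xy|$ is the distance in $X$; $\Delta\subset X^2$ is the diagonal; for $z=(x,y)\in X^2$, $|z|=|xy|$; $X^2$ carries the metric $|zz'|=\max\{|xx'|,|yy'|\}$. Spectral geometry (in the concrete form to which every axiomatically defined one is isomorphic): a triple $M=M(B,m)=\{\mathcal A,\mathcal H,ds\}$ where $B\subset X^2\setminus\Delta$ (the support) is symmetric under $(y,y')\mapsto(y',y)$ and $B_t=\{b\in B:|b|\ge t\}$ is finite for each $t>0$; $m:B\to\mathbb N$ is a symmetric function; $\mathcal H$ consists of square-summable sections $\xi$ on $B$, $\xi(y,y')\in\mathbb C^{m(y,y')}$; $\mathcal A$ is the algebra of Lipschitz functions on $X$ acting by $(\pi(a)\xi)(y,y')=a(y)\xi(y,y')$; $(ds\,\xi)(y,y')=|yy'|\xi(y',y)$. Density: $\mathrm{dens}(M)=\inf_{z\in X^2\setminus\Delta}\sup_{b\in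 B}|z|/|zb|$ (with $|z|/0=\infty$). Connectedness: for $t>0$ let $\Gamma_t$ be the graph with set of oriented edges $B_t$ and vertex set the projection of $B_t$ to $X$. $M$ is connected if $\Gamma_t$ is connected for all sufficiently small $t>0$. Deformation: a positive symmetric function $\rho:B\to\mathbb R$ (the marked spectrum), identified with the compact self-adjoint operator $(ds_\rho\xi)(y,y')=\rho(y,y')\xi(y',y)$. It is bounded if $\rho(y,y')/|yy'|$ is bounded and separated from zero on $B$. With $\mathcal D_\rho=ds_\rho^{-1}$, $\|[\mathcal D_\rho,\pi(a)]\|=\sup_{(y,y')\in B}|a(y)-a(y')|/\rho(y,y')$, and the Connes metric is $d_\rho(x,x')=\sup\{|a(x)-a(x')|:a\in\mathcal A,\ \|[\mathcal D_\rho,\pi(a)]\|\le1\}$. Compact-open topology on bounded deformations: the basic neighborhoods of $\rho_0$ are $\{\rho:|1/\rho(y,y')-1/\rho_0(y,y')|<\varepsilon\ \forall (y,y')\in B_t\}$, $t,\varepsilon>0$. *)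

(* Defs.v *)
From HB Require Import structures.
From mathcomp Require Import all_boot all_order all_algebra.
From mathcomp Require Import complex.
From mathcomp Require Import all_classical all_reals all_analysis.

Set Implicit Arguments.
Unset Strict Implicit.
Unset Printing Implicit Defensive.

Import Order.TTheory GRing.Theory Num.Theory.
Import numFieldNormedType.Exports.
Import Normc.

Local Open Scope classical_set_scope.
Local Open Scope ring_scope.

Definition len (R : realType) (X : metricType R) (z : X * X) : R :=
  mdist z.1 z.2.

Definition dist2 (R : realType) (X : metricType R) (z w : X * X) : R :=
  Num.max (mdist z.1 w.1) (mdist z.2 w.2).

(* The multiplicity [m : B -> {1, 2, ...}] is extended by 0 to all of
   [X * X]; the fibre of a section over a point outside [B] is then the zero
   space ['cV_0], so that a family indexed by [X * X] is a family indexed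
   by [B]. *)
Record spectral_geometry (R : realType) (X : metricType R) := SpectralGeometry {
  supp : set (X * X);
  mult : X * X -> nat;
  supp_offdiag : forall b, supp b -> b.1 <> b.2;
  supp_sym : forall b, supp b -> supp (b.2, b.1);
  supp_finite : forall t : R, 0 < t -> finite_set [set b | supp b /\ t <= len b];
  mult_supp : forall b, supp b <-> (0 < mult b)%N;
  mult_sym : forall b, mult (b.2, b.1) = mult b
}.

Section SpectralGeometry.
Context (R : realType) (X : metricType R) (M : spectral_geometry X).
Implicit Types (a : X -> R[i]) (rho : X * X -> R) (t e : R).

Definition supp_ge t : set (X * X) := [set b | supp M b /\ t <= len b].

(* In [\bar R], [r%:E / 0 = +oo] for [0 < r]. *)
Definition dens : \bar R :=
  ereal_inf [set ereal_sup [set (len z)%:E / (dist2 z b)%:E | b in supp M]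
            | z in [set z : X * X | z.1 <> z.2]]%E.

Definition vertices t : set X := fst @` supp_ge t `|` snd @` supp_ge t.

(* The empty graph counts as connected. *)
Definition graph_connected t : Prop :=
  forall x y, vertices t x -> vertices t y ->
  exists p : seq X, path (fun u v => `[< supp_ge t (u, v) >]) x p /\ last x p = y.

Definition sg_connected : Prop := \forall t \near 0^'+, graph_connected t.

Definition sections : Type := forall b : X * X, 'cV[R[i]]_(mult M b).

Implicit Types xi eta : sections.

Definition sqnorm xi : \bar R :=
  \esum_(b in supp M) (\sum_k normc (xi b k 0) ^+ 2)%:E.

Definition hnorm xi : \bar R := sqrte (sqnorm xi).

Definition hilbert : set sections := [set xi | (hnorm xi < +oo)%E].

Definition lipschitz_alg : set (X -> R[i]) :=
  [set a | exists K : R, forall x y, normc (a x - a y) <= K * mdist x y].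

Definition rep a xi : sections := fun b => a b.1 *: xi b.

Definition flip xi : sections :=
  fun b => castmx (mult_sym M b, erefl 1%N) (xi (b.2, b.1)).

Definition ds_ rho xi : sections := fun b => (rho b)%:C%C *: flip xi b.

Definition ds : sections -> sections := ds_ (@len R X).

Definition dirac_op_dom rho : set sections := ds_ rho @` hilbert.

(* The inverse of [ds_ rho] by [ds_dirac]; its domain is the range of
   [ds_ rho] on the Hilbert space. *)
Definition dirac_op rho xi : sections := fun b => (rho b)^-1%:C%C *: flip xi b.

Definition commutator rho a xi : sections :=
  fun b => dirac_op rho (rep a xi) b - rep a (dirac_op rho xi) b.

(* Operator norm of the commutator on the domain of [dirac_op rho]; the
   closed formula is [comm_normE]. *)
Definition comm_norm rho a : \bar R :=
  ereal_sup [set hnorm (commutator rho a xi)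
            | xi in [set xi | [/\ hilbert xi, dirac_op_dom rho xi & (hnorm xi <= 1)%E]]].

Definition connes rho (x y : X) : \bar R :=
  ereal_sup [set (normc (a x - a y))%:E
            | a in [set a | lipschitz_alg a /\ (comm_norm rho a <= 1)%E]].

(* Deformations are functions on [B]: the values of [rho] off [supp M] are
   irrelevant throughout. *)
Definition deformation rho : Prop :=
  forall b, supp M b -> 0 < rho b /\ rho (b.2, b.1) = rho b.

Definition bounded_deformation rho : Prop :=
  deformation rho /\
  exists c C : R, 0 < c /\ forall b, supp M b -> c <= rho b / len b <= C.

Definition co_ball rho t e : set (X * X -> R) :=
  [set rho' | forall b, supp_ge t b -> `|(rho' b)^-1 - (rho b)^-1| < e].

Definition co_nbhs rho : set_system (X * X -> R) :=
  filter_from [set te : R * R | 0 < te.1 /\ 0 < te.2]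
              (fun te => co_ball rho te.1 te.2).

End SpectralGeometry.

Section CommutatorNorm.
Context (R : realType) (X : metricType R) (M : spectral_geometry X).
Implicit Types (a : X -> R[i]) (rho : X * X -> R) (xi eta : sections M).

Lemma flipK : involutive (@flip R X M).
Proof.
move=> xi; apply: functional_extensionality_dep => -[x y]; apply/matrixP => i j.
rewrite /flip /= !castmxE /= !cast_ord_id; congr (xi _ _ _); exact: val_inj.
Qed.

Lemma mult0 b (v w : 'cV[R[i]]_(mult M b)) : ~ supp M b -> v = w.
Proof.
move=> nb; have m0 : mult M b = 0%N.
  by case: (posnP (mult M b)) => // /mult_supp.
by apply/matrixP => i; exfalso; have := leq_trans (ltn_ord i) (eq_leq m0).
Qed.

Lemma ds_dirac rho : deformation M rho ->
  cancel (ds_ rho) (@dirac_op R X M rho) /\ cancel (@dirac_op R X M rho) (ds_ rho).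
Proof.
move=> rhoP; split=> xi; apply: functional_extensionality_dep => b;
  (have [Bb|] := pselect (supp M b); last exact: mult0);
  have [r0 rs] := rhoP b Bb;
  rewrite -[in RHS](flipK xi) /dirac_op /ds_; apply/matrixP => i j;
  rewrite /flip ?mxE ?castmxE ?mxE ?castmxE /= ?castmxE; rewrite rs !mulrA -rmorphM /= ?mulVf ?mulfV ?gt_eqF// ?rmorph1 ?mul1r //.
Qed.

Lemma commutatorE rho a xi b : commutator rho a xi b =
  ((rho b)^-1%:C%C * (a b.2 - a b.1)) *: flip xi b.
Proof.
apply/matrixP => i j; rewrite /commutator /dirac_op /rep /flip !mxE !castmxE !mxE /=.
by rewrite mulrBr mulrBl !mulrA [a b.1 * _]mulrC.
Qed.

Definition sq xi b : R := \sum_k normc (xi b k 0) ^+ 2.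

Lemma sqZ (xi eta : sections M) b c : eta b = c *: xi b -> sq eta b = normc c ^+ 2 * sq xi b.
Proof.
move=> E; rewrite /sq mulr_sumr; apply: eq_bigr => k _.
by rewrite E !mxE normcM exprMn.
Qed.

Lemma sq_flip xi b : sq (flip xi) b = sq xi (b.2, b.1).
Proof.
rewrite /sq /flip; move: (mult_sym M b) (xi (b.2, b.1)) => E.
move: (mult M b) E => n E; case: n / E => v.
by apply: eq_bigr => k _; rewrite castmx_id.
Qed.

Lemma sq_ge0 xi b : 0 <= sq xi b.
Proof. by apply: sumr_ge0 => k _; rewrite sqr_ge0. Qed.

Lemma sqnorm_flip xi : sqnorm (flip xi) = sqnorm xi.
Proof.
rewrite [RHS](@reindex_esum _ _ _ (supp M) (supp M) (fun b => (b.2, b.1))).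
  by apply: eq_esum => b _; congr (_%:E); exact: sq_flip.
split.
- by move=> b; exact: supp_sym.
- by move=> [x y] [z w] _ _ [] -> ->.
- by move=> [x y] B; exists (y, x) => //; exact: (supp_sym B).
Qed.

Lemma esumZ_le (T : choiceType) (D : set T) (f : T -> R) (c : R) : 0 <= c ->
 (forall x, 0 <= f x) ->
 (\esum_(b in D) (c * f b)%:E <= c%:E * \esum_(b in D) (f b)%:E)%E.
Proof.
move=> c0 f0; apply: ge_ereal_sup => _ [A [fA AD]] <-.
under eq_fsbigr do rewrite EFinM.
rewrite -ge0_mule_fsumr//; apply: lee_wpmul2l; first by rewrite lee_fin.
by apply: ereal_sup_ubound; exists A.
Qed.

Lemma normc_ge0' (x : R[i]) : 0 <= normc x.
Proof. by case: x => u v; rewrite sqrtr_ge0. Qed.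

Lemma hnormZ_le (xi eta : sections M) (L : R) : 0 <= L ->
  (forall b, supp M b -> exists2 c, eta b = c *: flip xi b & normc c <= L) ->
  (hnorm eta <= L%:E * hnorm xi)%E.
Proof.
move=> L0 H.
have sq0 (x : sections M) : (0 <= sqnorm x)%E by apply: esum_ge0 => b _; rewrite lee_fin; exact: sq_ge0.
have -> : L%:E = sqrte (L ^+ 2)%:E by rewrite /sqrte sqrtr_sqr ger0_norm.
rewrite -sqrteM ?lee_fin ?sqr_ge0// lee_sqrt ?mule_ge0 ?lee_fin ?sqr_ge0//.
rewrite -(sqnorm_flip xi).
apply: le_trans (esumZ_le (supp M) (sqr_ge0 L) (sq_ge0 (flip xi))).
apply: le_esum => b Bb; have [c E cL] := H b Bb.
rewrite lee_fin -/(sq eta b) (sqZ E).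
apply: ler_wpM2r; first exact: sq_ge0.
by rewrite ler_pXn2r ?nnegrE ?normc_ge0'.
Qed.

Definition delta_sec b0 : sections M := fun b => \col_k ((b == b0) && (k == 0 :> nat))%:R.

Lemma sq_delta b0 b : supp M b0 -> sq (delta_sec b0) b = (b == b0)%:R.
Proof.
move=> /mult_supp B; rewrite /sq.
case: (eqVneq b b0) => [->|ne]; last first.
  by rewrite big1 // => k _; rewrite [delta_sec _ _ _ _](_ : _ = 0) ?normc0 ?expr0n// mxE (negbTE ne).
rewrite (bigD1 (Ordinal B))//= [delta_sec _ _ _ _](_ : _ = 1) ?normc1 ?expr1n; last by rewrite mxE eqxx.
rewrite big1 ?addr0//.
move=> k kn; have k0 : (k == 0 :> nat) = false by apply/negbTE: kn.
by rewrite [delta_sec _ _ _ _](_ : _ = 0) ?normc0 ?expr0n// mxE eqxx k0.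
Qed.

Lemma esum_single (b0 : X * X) (f : X * X -> R) : supp M b0 -> 0 <= f b0 -> (forall b, b != b0 -> f b = 0) ->
  (\esum_(b in supp M) (f b)%:E = (f b0)%:E)%E.
Proof.
move=> B f0 fz; rewrite -[RHS]/((EFin \o f) b0) -(@esum_set1 R _ b0 (EFin \o f))//.
rewrite [LHS]esum_mkcond [RHS]esum_mkcond; apply: eq_esum => b _ /=.
case: (eqVneq b b0) => [->|ne]; first by rewrite !mem_set.
by rewrite fz//; case: ifP; case: ifP.
Qed.

Lemma comm_normE rho a : deformation M rho ->
  comm_norm M rho a =
  ereal_sup (0%E |` [set (normc (a b.1 - a b.2) / rho b)%:E | b in supp M]).
Proof.
move=> rhoP; apply/le_anti/andP; split; last first.
  apply: ge_ereal_sup => _ [->|[b0 B <-]].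
    apply: le_ereal_sup_tmp; exists (hnorm (commutator rho a (fun b => 0) : sections M)).
      exists (fun b => 0) => //.
      have h0 : hnorm (fun b => 0 : 'cV_(mult M b)) = 0%E.
        rewrite /hnorm /sqnorm esum1 ?sqrte0// => b _.
        by rewrite big1// => k _; rewrite mxE normc0 expr0n.
      split.
      - by rewrite /hilbert /= h0 ltry.
      - exists (fun b => 0); first by rewrite /hilbert /= h0 ltry.
        apply: functional_extensionality_dep => b; apply/matrixP => i j.
        by rewrite /ds_ /flip !mxE castmxE mxE mulr0.
      - by rewrite h0.
    exact: sqrte_ge0.
  have [r0 rs] := rhoP _ B.
  have B' : supp M (b0.2, b0.1) by exact: supp_sym.
  pose xi := delta_sec (b0.2, b0.1).
  have nxi : hnorm xi = 1%E.
    rewrite /hnorm /sqnorm (esum_single (f := sq xi) B') ?sq_ge0//.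
      by rewrite sq_delta// eqxx /= sqrtr1.
    by move=> b ne; rewrite sq_delta// (negbTE ne).
  have bE b : (b == b0) = ((b.2, b.1) == (b0.2, b0.1)).
    by case: b => x y; case: (b0) => z w; rewrite !xpair_eqE andbC.
  apply: le_ereal_sup_tmp; exists (hnorm (commutator rho a xi)).
    exists xi => //; split; rewrite ?nxi //.
    - by rewrite /hilbert /= nxi ltry.
    - exists (dirac_op rho xi); last by have [_ ->] := ds_dirac rhoP.
      rewrite /hilbert /= /hnorm /sqnorm (esum_single (f := sq (dirac_op rho xi)) B).
      + by rewrite /= ltry.
      + exact: sq_ge0.
      + move=> b ne; rewrite (sqZ (xi := flip xi) (erefl _)) sq_flip sq_delta//.
        by rewrite -bE (negbTE ne) mulr0.
  rewrite /hnorm /sqnorm (esum_single (f := sq (commutator rho a xi)) B) ?sq_ge0//.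
    rewrite (sqZ (commutatorE rho a xi b0)) sq_flip sq_delta// eqxx mulr1.
    rewrite /sqrte sqrtr_sqr ger0_norm ?normc_ge0' // lee_fin normcM mulrC.
    rewrite -[a b0.2 - _]opprB normcN.
    rewrite /= expr0n /= addr0 sqrtr_sqr ger0_norm ?invr_ge0 ?(ltW r0)//.
  move=> b ne; rewrite (sqZ (commutatorE rho a xi b)) sq_flip sq_delta//.
  by rewrite -bE (negbTE ne) mulr0.
set S := ereal_sup _.
have S0 : (0 <= S)%E by apply: ereal_sup_ubound; left.
apply: ge_ereal_sup => _ [xi [_ _ xi1] <-].
case: (S) S0 (fun x => @ereal_sup_ubound R _ x : _ -> (x <= S)%E) => [L|_ _|//]; last exact: leey.
rewrite lee_fin => L0 HL.
apply: le_trans (_ : (L%:E * hnorm xi <= _)%E); last first.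
  by rewrite -[leRHS]mule1; apply: lee_wpmul2l.
apply: hnormZ_le => // b B.
exists ((rho b)^-1%:C%C * (a b.2 - a b.1)); first exact: commutatorE.
have [r0 rs] := rhoP _ B.
rewrite normcM /= expr0n /= addr0 sqrtr_sqr ger0_norm ?invr_ge0 ?(ltW r0)//.
rewrite mulrC -[a b.2 - _]opprB normcN -lee_fin; apply: HL; right; by exists b.
Qed.

End CommutatorNorm.

Section GromovHausdorff.
Context (R : realType).

Definition hausdorff_dist (Z : metricType R) (A B : set Z) : \bar R :=
  ereal_inf [set r%:E | r in [set r : R | [/\ 0 < r,
    forall x, A x -> exists2 y, B y & mdist x y < r &
    forall y, B y -> exists2 x, A x & mdist x y < r]]].

(* Distances take values in [\bar R], as the Connes metric is a supremum.
   An isometric embedding exists only if [d] is a (finite) metric, so that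
   [gh_dist] is [+oo] as soon as one of its arguments is not a metric. *)
Definition isometric_embedding (T : Type) (d : T -> T -> \bar R)
    (Z : metricType R) (f : T -> Z) : Prop :=
  injective f /\ forall x y, d x y = (mdist (f x) (f y))%:E.

Definition gh_dist (S T : Type) (dS : S -> S -> \bar R) (dT : T -> T -> \bar R) :
    \bar R :=
  ereal_inf [set r | exists (Z : metricType R) (f : S -> Z) (g : T -> Z),
    [/\ isometric_embedding dS f, isometric_embedding dT g &
        r = hausdorff_dist (range f) (range g)]].

End GromovHausdorff.

(* Main.v *)
(* By the density assumption, every function admissible for a deformation
   bounded by C|yy'| is Lipschitz with a constant depending only on C and the
   density: an increment g x - g x' is compared with the increment of g along
   an edge of the support close to (x,x'), and the error terms are absorbed
   because the density exceeds 2. Limits of functions admissible for rho_i are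
   then admissible for rho0, so by compactness d_i <= d_0 + e for large i,
   while d_0 <= d_i because rho0 <= rho_i. Finally, the metrics d_i on one
   copy of X and d_0 on another are glued to a metric on X + X in which the
   distance from x to y across the copies is d_0(x,y) + e. *)
From HB Require Import structures.
Require Import Defs.
From mathcomp Require Import all_boot all_order all_algebra.
From mathcomp Require Import complex ring lra.
From mathcomp Require Import all_classical all_reals all_analysis.

Set Implicit Arguments.
Unset Strict Implicit.
Unset Printing Implicit Defensive.

Import Order.TTheory GRing.Theory Num.Theory.
Import numFieldNormedType.Exports.
Import Normc.

Local Open Scope classical_set_scope.
Local Open Scope ring_scope.

(** * Ultrafilters and the complex modulus *)

Lemma ultrafilter_fmap (T V : Type) (f : T -> V) (U : set_system T) :
  UltraFilter U -> UltraFilter (f @ U).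
Proof.
move=> UU; split; first exact: fmap_proper_filter.
move=> G PG UG; rewrite eqEsubset; split=> // A GA.
have [//|UnA] := in_ultra_setVsetC (f @^-1` A) UU.
have GnA : G (~` A) by exact: UG.
by have [t []] := filter_ex (filterI GA GnA).
Qed.

Lemma normr_Re_le_normc (R : realType) (z : R[i]) : `|complex.Re z| <= normc z.
Proof.
case: z => p q /=.
by rewrite -sqrtr_sqr ler_sqrt ?addr_ge0 ?sqr_ge0// lerDl sqr_ge0.
Qed.

Lemma normc_conj (R : realType) (z : R[i]) : normc (conjc z) = normc z.
Proof. by case: z => p q /=; rewrite sqrrN. Qed.

(** * Reduction of the Connes metric to real functions *)

Section Admissible.
Context (R : realType) (X : metricType R) (M : spectral_geometry X).
Implicit Types (g : X -> R) (rho : X * X -> R).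

(** The real-valued unit ball of the commutator norm. The constant [K] only expresses membership in
    the algebra and is not uniform in [g]. *)
Definition admissible rho g : Prop :=
  (exists K : R, forall x y, `|g x - g y| <= K * mdist x y) /\
  forall b, supp M b -> `|g b.1 - g b.2| <= rho b.

Lemma comm_norm_le1 rho (a : X -> R[i]) : deformation M rho ->
  (comm_norm M rho a <= 1)%E <->
  forall b, supp M b -> normc (a b.1 - a b.2) <= rho b.
Proof.
move=> rhoP; rewrite comm_normE//; split=> [H b Bb|H].
  have [r0 _] := rhoP _ Bb.
  have : ((normc (a b.1 - a b.2) / rho b)%:E <= 1)%E.
    by apply: le_trans H; apply: ereal_sup_ubound; right; exists b.
  by rewrite lee_fin ler_pdivrMr// mul1r.
apply: ge_ereal_sup => _ [->|[b Bb <-]]; first by rewrite lee_fin.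
by have [r0 _] := rhoP _ Bb; rewrite lee_fin ler_pdivrMr// mul1r; exact: H.
Qed.

(* The real part of a complex function, after multiplication by the phase
   that makes its increment from y to x real and nonnegative. *)
Lemma connesE rho x y : deformation M rho ->
  connes M rho x y = ereal_sup [set (g x - g y)%:E | g in admissible rho].
Proof.
move=> rhoP; apply/le_anti/andP; split.
  apply: ge_ereal_sup => _ [a [[K aK] /(comm_norm_le1 _ rhoP) aB]] <-.
  set w := a x - a y.
  (* If [w = 0], division by zero makes [g] vanish, which is then a valid choice. *)
  pose g u := complex.Re (conjc w * a u) / normc w.
  have gE u v : g u - g v = complex.Re (conjc w * (a u - a v)) / normc w.
    rewrite /g -mulrBl; congr (_ / _).
    by case: (conjc w) (a u) (a v) => [p q] [r s] [r' s'] /=; ring.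
  have gle u v : `|g u - g v| <= normc (a u - a v).
    rewrite gE; have [->|w0] := eqVneq (normc w) 0.
      by rewrite invr0 mulr0 normr0 normc_ge0'.
    have wp : 0 < normc w by rewrite lt_neqAle eq_sym w0 normc_ge0'.
    rewrite normrM normfV (gtr0_norm wp) ler_pdivrMr//.
    by apply: le_trans (normr_Re_le_normc _) _; rewrite normcM normc_conj mulrC.
  apply: ereal_sup_ubound; exists g.
    split; first by exists K => u v; exact: le_trans (gle _ _) (aK _ _).
    by move=> b Bb; exact: le_trans (gle _ _) (aB _ Bb).
  rewrite gE -/w; congr EFin.
  have [w0|w0] := eqVneq (normc w) 0.
    by rewrite w0 invr0 mulr0.
  apply: (mulIf w0); rewrite mulfVK//.
  case: (w) => p q /=; rewrite -[RHS]expr2 sqr_sqrtr ?addr_ge0 ?sqr_ge0//.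
  by rewrite mulNr opprK !expr2.
apply: ge_ereal_sup => _ [g [[K gK] gB]] <-.
have E u v : normc ((g u)%:C%C - (g v)%:C%C) = `|g u - g v|.
  by rewrite -rmorphB /= expr0n /= addr0 sqrtr_sqr.
apply: le_ereal_sup_tmp; exists (normc ((g x)%:C%C - (g y)%:C%C))%:E; last first.
  by rewrite lee_fin E ler_norm.
exists (fun u => (g u)%:C%C) => //; split; first by exists K => u v; rewrite E.
by apply/comm_norm_le1 => // b Bb; rewrite E; exact: gB.
Qed.

(** * Density and the uniform Lipschitz bound *)

Lemma dens_approx (r : R) x y : 0 < r -> (r%:E < dens M)%E -> x <> y ->
  exists2 b, supp M b & r * dist2 (x, y) b <= mdist x y.
Proof.
move=> r0 rD xy.
have : (r%:E < ereal_sup [set (len (x, y))%:E / (dist2 (x, y) b)%:E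
   | b in supp M])%E.
  by apply: lt_le_trans rD _; apply: ereal_inf_lbound; exists (x, y).
move=> /ereal_sup_gt[_ [b Bb <-]] h; exists b => //.
have : 0 <= dist2 (x, y) b by rewrite le_max mdist_ge0.
(* At distance 0 the quotient is infinite, but the product form still holds. *)
rewrite le_eqVlt => /predU1P[<-|d0]; first by rewrite mulr0 mdist_ge0.
by move: h; rewrite inver gt_eqF// -EFinM lte_fin ltr_pdivlMr// => /ltW.
Qed.

(* A Lipschitz constant k of g improves to C(1 + 2/r) + (2/r)k, by
   comparing (x,y) with a point of the support within |xy|/r of it. *)
Lemma admissible_lipschitz (r C : R) rho g x y :
  2 < r -> (r%:E < dens M)%E ->
  0 <= C -> (forall b, supp M b -> rho b <= C * len b) ->
  admissible rho g -> `|g x - g y| <= C * (r + 2) / (r - 2) * mdist x y.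
Proof.
move=> r2 rD C0 rhoC [[K gK] gB].
have r0 : 0 < r by lra.
pose S := [set k : R | 0 <= k /\ forall u v, `|g u - g v| <= k * mdist u v].
have S0 : S !=set0.
  exists `|K|; split=> // u v; apply: le_trans (gK u v) _.
  by rewrite ler_wpM2r ?mdist_ge0// ler_norm.
have Slb : lbound S 0 by move=> k [].
(* The infimum is attained: for [u <> v] the quotient of |g u - g v| by |uv| is a lower bound of
   [S]. *)
have infS : S (inf S).
  split; first exact: lb_le_inf.
  move=> u v; have [->|uv] := eqVneq u v.
    by rewrite subrr normr0 mulr_ge0 ?mdist_ge0//; exact: lb_le_inf.
  have uv0 : 0 < mdist u v by rewrite mdist_gt0.
  rewrite -ler_pdivrMr//; apply: lb_le_inf => // k [_ gk].
  by rewrite ler_pdivrMr.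
set k := inf S in infS; have [k0 gk] := infS.
(* Each endpoint moves by at most |uv|/r, at rate [k]; the edge [b] has length at most (1 +
   2/r)|uv|, and [g] varies along it by at most C times that. *)
have improve : S ((C * (r + 2) + 2 * k) / r).
  split; first by rewrite divr_ge0 ?addr_ge0 ?mulr_ge0//; lra.
  move=> u v; have [->|/eqP uv] := eqVneq u v.
    by rewrite subrr normr0 mdistxx mulr0.
  have [b Bb hb] := dens_approx r0 rD uv.
  have {hb} : r * mdist u b.1 <= mdist u v /\ r * mdist v b.2 <= mdist u v.
    by split; apply: le_trans hb; rewrite ler_pM2l// le_max lexx ?orbT.
  move=> [h1 h2].
  have g1 := gk u b.1; have g2 := gk v b.2.
  have g3 := le_trans (gB b Bb) (rhoC b Bb).
  have t1 := metric_triangle b.1 u b.2; have t2 := metric_triangle u v b.2.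
  rewrite (metric_sym b.1 u) in t1.
  have t3 : C * len b <= C * (mdist u b.1 + mdist u v + mdist v b.2).
    by rewrite ler_wpM2l// /len; lra.
  have k1 := ler_wpM2l k0 h1; have k2 := ler_wpM2l k0 h2.
  have c1 := ler_wpM2l C0 h1; have c2 := ler_wpM2l C0 h2.
  rewrite mulrAC ler_pdivlMr//.
  have : `|g u - g v| <= k * mdist u b.1 +
      C * (mdist u b.1 + mdist u v + mdist v b.2) + k * mdist v b.2.
    move: g1 g2 g3 t3; rewrite !ler_norml => /andP[? ?] /andP[? ?] /andP[? ?] ?.
    by apply/andP; split; lra.
  move=> H; have := ler_wpM2r (ltW r0) H; lra.
(* Minimality of [k] gives an inequality with slope 2/r < 1 in [k], which can be solved for [k]. *)
have kle : k <= (C * (r + 2) + 2 * k) / r.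
  by apply: ge_inf => //; exists 0.
have {}kle : k <= C * (r + 2) / (r - 2).
  rewrite ler_pdivlMr; last lra.
  by move: kle; rewrite ler_pdivlMr//; lra.
by apply: le_trans (gk x y) _; rewrite ler_wpM2r// mdist_ge0.
Qed.

(** * The Connes metric as a real-valued metric *)

Definition connes_dist rho (x y : X) : R := fine (connes M rho x y).

Section ConnesDist.
Context (rho : X * X -> R) (c L : R).
Hypotheses (rhoP : deformation M rho) (c0 : 0 < c).
Hypothesis rho_ge : forall b, supp M b -> c * len b <= rho b.
Hypothesis adm_lip :
  forall g x y, admissible rho g -> `|g x - g y| <= L * mdist x y.

Lemma admissible_cst (k : R) : admissible rho (fun=> k).
Proof.
split; first by exists 0 => x y; rewrite subrr normr0 mul0r.
by move=> b Bb; rewrite subrr normr0 ltW//; case: (rhoP Bb).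
Qed.

(** The zero function is admissible, which excludes -oo, and [L] bounds every increment, which
    excludes +oo. *)
Lemma connes_distE x y : connes M rho x y = (connes_dist rho x y)%:E.
Proof.
rewrite /connes_dist fineK// fin_real// connesE//; apply/andP; split.
  apply: (@lt_le_trans _ _ 0%E); first exact: ltNyr.
  by apply: ereal_sup_ubound; exists (fun=> 0); [exact: admissible_cst|rewrite subrr].
apply: (@le_lt_trans _ _ (L * mdist x y)%:E); last exact: ltry.
apply: ge_ereal_sup => _ [g gadm <-]; rewrite lee_fin.
by apply: le_trans (adm_lip _ _ gadm); exact: ler_norm.
Qed.

Lemma connes_dist_ub g x y : admissible rho g -> g x - g y <= connes_dist rho x y.
Proof.
move=> gadm; rewrite -lee_fin -connes_distE connesE//.
by apply: ereal_sup_ubound; exists g.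
Qed.

Lemma connes_dist_le (k : R) x y :
  (forall g, admissible rho g -> g x - g y <= k) -> connes_dist rho x y <= k.
Proof.
move=> H; rewrite -lee_fin -connes_distE connesE//.
by apply: ge_ereal_sup => _ [g gadm <-]; rewrite lee_fin; exact: H.
Qed.

Lemma connes_dist_lip x y : connes_dist rho x y <= L * mdist x y.
Proof.
apply: connes_dist_le => g gadm.
by apply: le_trans (adm_lip _ _ gadm); exact: ler_norm.
Qed.

Lemma connes_distxx x : connes_dist rho x x = 0.
Proof.
apply/le_anti/andP; split; first by apply: connes_dist_le => g _; rewrite subrr.
by have := connes_dist_ub x x (admissible_cst 0); rewrite subrr.
Qed.

Lemma connes_dist_triangle y x z :
  connes_dist rho x z <= connes_dist rho x y + connes_dist rho y z.
Proof.
apply: connes_dist_le => g gadm.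
by have := connes_dist_ub x y gadm; have := connes_dist_ub y z gadm; lra.
Qed.

Lemma connes_dist_sym x y : connes_dist rho x y = connes_dist rho y x.
Proof.
suff H u v : connes_dist rho u v <= connes_dist rho v u by apply/le_anti; rewrite !H.
apply: connes_dist_le => g [[K gK] gB].
have : admissible rho (fun w => - g w).
  split; first by exists K => s t; rewrite -opprD normrN.
  by move=> b Bb; rewrite -opprD normrN; exact: gB.
by move=> /(connes_dist_ub v u); lra.
Qed.

(** The test function is [c] times the distance to [y], admissible by [rho_ge]. This bound makes the
    metric nondegenerate. *)
Lemma connes_dist_ge x y : c * mdist x y <= connes_dist rho x y.
Proof.
pose g u := c * mdist u y.
have glip u v : `|g u - g v| <= c * mdist u v.
  rewrite -mulrBr normrM (gtr0_norm c0) ler_pM2l// ler_norml.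
  have := metric_triangle u v y; have := metric_triangle v u y.
  by rewrite (metric_sym v u) => ? ?; apply/andP; split; lra.
have : admissible rho g.
  split; first by exists c.
  by move=> b Bb; apply: le_trans (glip _ _) _; exact: rho_ge.
by move=> /(connes_dist_ub x y); rewrite /g mdistxx mulr0 subr0.
Qed.

Lemma connes_dist_eq0 x y : connes_dist rho x y = 0 -> x = y.
Proof.
move=> d0; have := connes_dist_ge x y; rewrite d0 => H.
apply: mdist_positivity; apply/le_anti; rewrite mdist_ge0 andbT.
by rewrite -(pmulr_rle0 _ c0).
Qed.

End ConnesDist.

End Admissible.

(** * Uniform upper bound by compactness *)

(* If the claim fails, choose violating x_i, y_i and admissible functions for
   infinitely many i; their limits along an ultrafilter violate the
   definition of d. *)
Lemma admissible_limsup (R : realType) (X : metricType R)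
    (M : spectral_geometry X) (rho0 : X * X -> R) (rho_ : nat -> X * X -> R)
    (L e : R) (d : X -> X -> R) :
  compact [set: X] -> 0 <= L -> 0 < e ->
  (forall i g x y, admissible M (rho_ i) g -> `|g x - g y| <= L * mdist x y) ->
  (forall b, supp M b -> rho_ i b @[i --> \oo] --> rho0 b) ->
  (forall g x y, admissible M rho0 g -> g x - g y <= d x y) ->
  (forall x y, d x y <= L * mdist x y) ->
  (forall y x z, d x z <= d x y + d y z) ->
  \forall i \near \oo, forall g x y, admissible M (rho_ i) g ->
    g x - g y <= d x y + e.
Proof.
move=> Xcpt L0 e0 adm_lip rho_cvg d_ub d_lip d_tri; apply: contrapT => Nev.
pose good i := forall g x y, admissible M (rho_ i) g -> g x - g y <= d x y + e.
(* The trace of the filter at infinity on the bad indices is proper, since bad indices occur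
   arbitrarily far out. *)
pose F := within (fun i => ~ good i) \oo.
have PF : ProperFilter F.
  apply: Build_ProperFilter_ex => A FA; apply: contrapT => A0; apply: Nev.
  apply: (filterS (F := \oo) _ FA) => i Ai; apply: contrapT => ngood.
  by apply: A0; exists i; exact: Ai.
have [U [UU FU]] := ultraFilterLemma PF.
have ooU : \oo `<=` U by move=> A ooA; apply: FU; apply: filterS ooA => i.
have Ubad : U (fun i => ~ good i) by apply: FU; exact: withinT.
(* A bad index supplies a point [p] of [X], which serves as base point and as default value. *)
have [i0 bad0] := filter_ex Ubad.
have /existsNP[_ /existsNP[p _]] := bad0.
have /choice[f fP] (i : nat) : exists t : (X -> R) * X * X, ~ good i ->
    admissible M (rho_ i) t.1.1 /\ d t.1.2 t.2 + e < t.1.1 t.1.2 - t.1.1 t.2.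
  have [gi|] := pselect (good i); first by exists (fun=> 0, p, p).
  move=> /existsNP[g /existsNP[x /existsNP[y /not_implyP[gadm /negP]]]].
  by rewrite -ltNge => h; exists (g, x, y).
pose g i := (f i).1.1; pose x i := (f i).1.2; pose y i := (f i).2.
have Uadm : \forall i \near U, admissible M (rho_ i) (g i).
  by apply: filterS Ubad => i /fP[].
have Ubig : \forall i \near U, d (x i) (y i) + e < g i (x i) - g i (y i).
  by apply: filterS Ubad => i /fP[].
have cptU (z : nat -> X) : exists l : X, z @ U --> l.
  have := Xcpt; rewrite compact_ultra => H.
  by have [|l [_ zl]] := H _ (ultrafilter_fmap z UU);
    [exact: filterT|exists l].
have [x' xx'] := cptU x; have [y' yy'] := cptU y.
(* Normalised at [p], the values at [u] stay in a compact segment, so the functions converge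
   pointwise along [U]. *)
have /choice[a ga] (u : X) : exists l : R, (g i u - g i p) @[i --> U] --> l.
  have := @segment_compact R (- (L * mdist u p)) (L * mdist u p).
  rewrite compact_ultra => H.
  have [|l [_ gl]] := H _ (ultrafilter_fmap (fun i => g i u - g i p) UU);
    last by exists l.
  apply: filterS Uadm => i iadm; have := adm_lip _ _ u p iadm.
  by rewrite ler_norml /= in_itv.
have near_a u (s : R) : 0 < s -> \forall i \near U, `|a u - (g i u - g i p)| < s.
  by move=> s0; move: s s0; apply/cvgrPdist_lt; exact: ga.
have a_adm : admissible M rho0 a.
  split.
    exists L => u v; apply/ler_addgt0Pl => s s0.
    have s2 : 0 < s / 2 by rewrite divr_gt0.
    have [i [[iadm iu] iv]] := filter_ex (filterI
      (filterI Uadm (near_a u _ s2))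
      (near_a v _ s2)).
    move: iu iv (adm_lip _ _ u v iadm); rewrite !ltr_norml !ler_norml.
    by move=> /andP[? ?] /andP[? ?] /andP[? ?]; apply/andP; split; lra.
  move=> b Bb; apply/ler_addgt0Pl => s s0.
  have s3 : 0 < s / 3 by rewrite divr_gt0.
  have Urho : \forall i \near U, `|rho0 b - rho_ i b| < s / 3.
    by have /cvgrPdist_lt/(_ _ s3) := rho_cvg b Bb; exact: ooU.
  have [i [[[[_ iB] iu] iv] irho]] := filter_ex (filterI (filterI
    (filterI Uadm (near_a b.1 _ s3)) (near_a b.2 _ s3)) Urho).
  move: iu iv irho (iB b Bb); rewrite !ltr_norml !ler_norml.
  by move=> /andP[? ?] /andP[? ?] /andP[? ?] /andP[? ?]; apply/andP; split; lra.
(* Error budget: 2s for replacing [g i] by [a] at [x'] and [y'], and 2Ls each in [g i] and in [d]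
   for moving [x i], [y i] to their limits. *)
have t0 : 0 < 2 + 4 * L by lra.
pose s := e / (2 + 4 * L).
have s0 : 0 < s by rewrite divr_gt0.
have sE : s * (2 + 4 * L) = e by rewrite divfK// gt_eqF.
have nearX (z : nat -> X) (l : X) : z @ U --> l ->
    \forall i \near U, mdist l (z i) < s.
  by move=> zl; exact: (metricType_numDomainType.cvgr_dist_lt zl).
have [i [[[[[iadm ibig] ix] iy] iax] iay]] := filter_ex (filterI (filterI
  (filterI (filterI (filterI Uadm Ubig) (nearX _ _ xx')) (nearX _ _ yy'))
  (near_a x' _ s0)) (near_a y' _ s0)).
have gx := adm_lip _ _ x' (x i) iadm; have gy := adm_lip _ _ y' (y i) iadm.
have axy := d_ub _ x' y' a_adm.
have d1 := d_tri (x i) x' y'; have d2 := d_tri (y i) (x i) y'.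
have d3 := d_lip x' (x i); have d4 := d_lip (y i) y'.
rewrite metric_sym in d4.
have l1 := ler_wpM2l L0 (ltW ix); have l2 := ler_wpM2l L0 (ltW iy).
move: gx gy iax iay; rewrite !ltr_norml !ler_norml.
by move=> /andP[? ?] /andP[? ?] /andP[? ?] /andP[? ?]; lra.
Qed.

(** * Gluing and the Gromov-Hausdorff distance *)

Lemma gh_dist_le (R : realType) (T : choiceType) (d d0 : T -> T -> R) (e : R) :
  0 < e ->
  (forall x, d x x = 0) -> (forall x, d0 x x = 0) ->
  (forall x y, d x y = 0 -> x = y) -> (forall x y, d0 x y = 0 -> x = y) ->
  (forall x y, d x y = d y x) -> (forall x y, d0 x y = d0 y x) ->
  (forall y x z, d x z <= d x y + d y z) ->
  (forall y x z, d0 x z <= d0 x y + d0 y z) ->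
  (forall x y, d0 x y <= d x y <= d0 x y + e) ->
  (gh_dist (fun x y => (d x y)%:E) (fun x y => (d0 x y)%:E) <= (2 * e)%:E)%E.
Proof.
move=> e0 dxx d0xx deq0 d0eq0 dC d0C dtri d0tri dd0.
have d0d x y : d0 x y <= d x y by have /andP[] := dd0 x y.
have dle x y : d x y <= d0 x y + e by have /andP[] := dd0 x y.
have d0_ge0 x y : 0 <= d0 x y.
  by have := d0tri y x x; rewrite d0xx (d0C y x); lra.
pose D (u v : T + T) : R := match u, v with
  | inl x, inl y => d x y | inr x, inr y => d0 x y
  | inl x, inr y | inr x, inl y => d0 x y + e end.
have Dxx u : D u u = 0 by case: u => x /=.
have Deq0 u v : D u v = 0 -> u = v.
  case: u v => [x|x] [y|y] /= H.
  - by rewrite (deq0 _ _ H).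
  - by exfalso; have := d0_ge0 x y; lra.
  - by exfalso; have := d0_ge0 x y; lra.
  - by rewrite (d0eq0 _ _ H).
have DC u v : D u v = D v u by case: u v => [x|x] [y|y] /=; rewrite 1?dC 1?d0C.
have Dtri v u w : D u w <= D u v + D v w.
  case: u v w => [x|x] [y|y] [z|z] /=;
    have := dtri y x z; have := d0tri y x z; have := d0d x y; have := d0d y z;
    have := d0d x z; have := dle x z; lra.
pose Z : metricType R := HB.pack (T + T)%type
  (isMetric.Build R (T + T)%type Dxx Deq0 DC Dtri).
apply: ge_ereal_inf.
exists (hausdorff_dist (range (inl : T -> Z)) (range (inr : T -> Z))).
  exists Z, inl, inr; split=> //; split=> //.
  - by move=> x y [].
  - by move=> x y [].
(* The two copies of a point are at distance exactly [e], while [hausdorff_dist] asks for strict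
   inequalities. *)
apply: ereal_inf_lbound; exists (2 * e) => //; split.
- by rewrite mulr_gt0.
- move=> _ [x _ <-]; exists (inr x); first by exists x.
  by rewrite /mdist /= d0xx; lra.
- move=> _ [x _ <-]; exists (inl x); first by exists x.
  by rewrite /mdist /= d0xx; lra.
Qed.

Lemma gh_dist_ge0 (R : realType) (S T : Type) (dS : S -> S -> \bar R)
  (dT : T -> T -> \bar R) : (0 <= gh_dist dS dT)%E.
Proof.
apply: le_ereal_inf_tmp => _ [Z [f [g [_ _ ->]]]].
by apply: le_ereal_inf_tmp => _ [r [r0 _ _] <-]; rewrite lee_fin ltW.
Qed.

(** * Convergence of the deformations and of their metrics *)

(** The topology compares reciprocals on long edges. The threshold t = |b| includes [b] itself, and
    the nonzero limit can be inverted. *)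
Lemma co_nbhs_cvg (R : realType) (X : metricType R) (M : spectral_geometry X)
    (rho0 : X * X -> R) (rho_ : nat -> X * X -> R) b :
  0 < rho0 b -> cvg_to (rho_ @ \oo) (co_nbhs M rho0) -> supp M b ->
  rho_ i b @[i --> \oo] --> rho0 b.
Proof.
move=> r0 rho_cvg Bb.
have len0 : 0 < len b.
  by rewrite /len mdist_gt0; apply/eqP; exact: supp_offdiag Bb.
have H : (rho_ i b)^-1 @[i --> \oo] --> (rho0 b)^-1.
  apply/cvgrPdist_lt => e e0.
  have /rho_cvg : co_nbhs M rho0 (co_ball M rho0 (len b) e) by exists (len b, e).
  move=> near_rho; apply: (filterS (F := \oo) _ near_rho) => i /(_ b).
  by rewrite distrC; apply.
rewrite -[rho0 b]invrK; have -> : (fun i => rho_ i b) = (fun i => ((rho_ i b)^-1)^-1).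
  by apply/funext => i; rewrite invrK.
by apply: cvgV => //; rewrite invr_neq0// gt_eqF.
Qed.

(* Sequences are indexed from 0: [rho_ i] is the (i+1)-st deformation. *)
Theorem theorem3p3 (R : realType) (X : metricType R) (M : spectral_geometry X)
    (rho0 : X * X -> R) (rho_ : nat -> X * X -> R) (C : R) :
  compact [set: X] ->
  sg_connected M ->
  (2%:E < dens M)%E ->
  bounded_deformation M rho0 ->
  (forall i, deformation M (rho_ i)) ->
  cvg_to (rho_ @ \oo) (co_nbhs M rho0) ->
  0 < C ->
  (forall i b, supp M b -> rho0 b <= rho_ i b <= C * len b) ->
  gh_dist (connes M (rho_ i)) (connes M rho0) @[i --> \oo] --> 0%E.
Proof.
move=> Xcpt _ D2 [rho0P [c [C1 [c0 rho0_bd]]]] rhoP rho_cvg C0 rho_le.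
(* Strict room above 2 is needed: the midpoint of 2 and a finite density, or 3 if the density is
   infinite. *)
have [r r2 rD] : exists2 r : R, 2 < r & (r%:E < dens M)%E.
  case: (dens M) D2 => [s||] //.
    by rewrite lte_fin => s2; exists ((2 + s) / 2); rewrite ?lte_fin; lra.
  by exists 3; rewrite ?ltry//; lra.
pose L := C * (r + 2) / (r - 2).
have L0 : 0 <= L by rewrite /L divr_ge0 ?mulr_ge0//; lra.
have lip rho : (forall b, supp M b -> rho b <= C * len b) -> forall g x y,
    admissible M rho g -> `|g x - g y| <= L * mdist x y.
  by move=> rhoC g x y; apply: admissible_lipschitz => //; exact: ltW.
(* Any term of the sequence transfers the bound C|yy'| to [rho0]; index 0 is taken. *)
have lip0 : forall g x y, admissible M rho0 g -> `|g x - g y| <= L * mdist x y.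
  by apply: lip => b Bb; have /andP[] := rho_le 0%N b Bb; exact: le_trans.
have lip_ i : forall g x y, admissible M (rho_ i) g -> `|g x - g y| <= L * mdist x y.
  by apply: lip => b Bb; have /andP[] := rho_le i b Bb.
have rho0_ge b : supp M b -> c * len b <= rho0 b.
  move=> Bb; have /andP[+ _] := rho0_bd b Bb; rewrite ler_pdivlMr//.
  by rewrite /len mdist_gt0; apply/eqP; exact: supp_offdiag Bb.
have rho_ge i b : supp M b -> c * len b <= rho_ i b.
  by move=> Bb; have /andP[+ _] := rho_le i b Bb; apply: le_trans; exact: rho0_ge.
have unif (e : R) : 0 < e -> \forall i \near \oo, forall x y,
    connes_dist M (rho_ i) x y <= connes_dist M rho0 x y + e.
  move=> e0.
  have cvg_b b : supp M b -> rho_ i b @[i --> \oo] --> rho0 b.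
    by move=> Bb; apply: (co_nbhs_cvg _ rho_cvg Bb); have [] := rho0P b Bb.
  have := admissible_limsup Xcpt L0 e0 lip_ cvg_b
    (fun g x y => connes_dist_ub rho0P lip0 x y) (connes_dist_lip rho0P lip0)
    (connes_dist_triangle rho0P lip0).
  apply: filterS => i H x y; apply: connes_dist_le; [exact: rhoP|exact: lip_|].
  by move=> g; exact: H.
have gh_le (e : R) : 0 < e -> \forall i \near \oo,
    (0 <= gh_dist (connes M (rho_ i)) (connes M rho0) <= e%:E)%E.
  move=> e0; have e2 : 0 < e / 2 by rewrite divr_gt0.
  apply: filterS (unif _ e2) => i Hi; rewrite gh_dist_ge0/=.
  have -> : connes M (rho_ i) = (fun x y => (connes_dist M (rho_ i) x y)%:E).
    apply/funext => x; apply/funext => y.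
    exact: (connes_distE (rhoP i) (lip_ i)).
  have -> : connes M rho0 = (fun x y => (connes_dist M rho0 x y)%:E).
    by apply/funext => x; apply/funext => y; exact: (connes_distE rho0P lip0).
  have -> : e = 2 * (e / 2) by rewrite mulrC divfK.
  apply: gh_dist_le => //.
  - exact: (connes_distxx (rhoP i) (lip_ i)).
  - exact: (connes_distxx rho0P lip0).
  - exact: (connes_dist_eq0 (rhoP i) c0 (rho_ge i) (lip_ i)).
  - exact: (connes_dist_eq0 rho0P c0 rho0_ge lip0).
  - exact: (connes_dist_sym (rhoP i) (lip_ i)).
  - exact: (connes_dist_sym rho0P lip0).
  - exact: (connes_dist_triangle (rhoP i) (lip_ i)).
  - exact: (connes_dist_triangle rho0P lip0).
  (* Enlarging the deformation enlarges the set of admissible functions. *)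
  - move=> x y; apply/andP; split; last exact: Hi.
    apply: (connes_dist_le rho0P lip0) => g [gL gB].
    apply: (connes_dist_ub (rhoP i) (lip_ i)); split=> // b Bb.
    by apply: le_trans (gB b Bb) _; have /andP[] := rho_le i b Bb.
(* Convergence in the extended reals splits into eventual finiteness and convergence of the real
   values. *)
apply/fine_cvgP; split.
  apply: filterS (gh_le 1 ltr01) => i /andP[h0 h1].
  by rewrite ge0_fin_numE// (le_lt_trans h1) ?ltry.
apply/cvgrPdist_le => e e0; apply: filterS (gh_le e e0) => i /andP[h0 h1] /=.
rewrite sub0r normrN ger0_norm ?fine_ge0// -lee_fin fineK//.
by rewrite ge0_fin_numE// (le_lt_trans h1) ?ltry.
Qed.
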